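(* Let $\mathcal{M}'_m$ (resp. $\mathcal{M}''_m$) be a meridian surface of elliptic (resp. hyperbolic) type in $\mathbb{R}^4_1$ from the general class. (i) $\mathcal{M}'_m$ has constant invariant $k=\mathrm{const}=-a^2$, $a\neq0$, if and only if the curve $c$ on $S^2(1)$ has constant spherical curvature $\kappa=\mathrm{const}=b$, $b\neq0$, and the meridian $m$ is determined by $\dot f=y(f)$, where $$y(t)=\sqrt{1+\left(C\pm\frac{at^2}{2b}\right)^2},\qquad C=\mathrm{const},$$ and $g(u)$ is defined by $\dot g(u)=\sqrt{\dot f^2(u)-1}$. (ii) $\mathcal{M}''_m$ has constant invariant $k=\mathrm{const}=-a^2$, $a\neq0$, if and only if the curve $c$ on $S^2_1(1)$ has constant spherical curvature $\kappa=\mathrm{const}=b$, $b\neq0$, and the meridian $m$ is determined by $\dot f=y(f)$, where $$y(t)=\sqrt{1-\left(C\mp\frac{at^2}{2b}\right)^2},\qquad C=\mathrm{const},$$ and $g(u)$ is defined by $\dot g(u)=\sqrt{1-\dot f^2(u)}$.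
   Context: $\mathbb{R}^4_1$ is Minkowski 4-space with metric $\langle\cdot,\cdot\rangle$ of signature $(3,1)$ and orthonormal basis $e_1,e_2,e_3,e_4$, $\langle e_i,e_i\rangle=1$ for $i=1,2,3$, $\langle e_4,e_4\rangle=-1$. Dots denote $d/du$; $I,J\subset\mathbb{R}$ are intervals; all functions are smooth. Meridian surface of elliptic type: $\mathcal{M}'_m: z(u,v)=f(u)\,l(v)+g(u)\,e_4$, $u\in I$, $v\in J$, where $f>0$, $\dot f^2-\dot g^2=1$, and $c: l=l(v)$ is a smooth curve parameterized by arc length ($\langle l',l'\rangle=1$) on the unit sphere $S^2(1)$ centered at the origin of the Euclidean space $\mathrm{span}\{e_1,e_2,e_3\}$. Put $t=l'$ and let $n$ be a smooth unit vector field with $\{l,t,n\}$ an orthonormal frame of $\mathrm{span}\{e_1,e_2,e_3\}$; the spherical curvature of $c$ is $\kappa(v)=\langle t'(v),n(v)\rangle$. Meridian surface of hyperbolic type: $\mathcal{M}''_m: z(u,v)=f(u)\,l(v)+g(u)\,e_1$, $u\in I$, $v\in J$, where $f>0$, $\dot f^2+\dot g^2=1$, and $c: l=l(v)$ is a smooth curve with $\langle l',l'\rangle=1$ on the de Sitter space $S^2_1(1)=\{V:\langle V,V\rangle=1\}$ in $\mathrm{span}\{e_2,e_3,e_4\}$. Put $t=l'$ and let $n$ be a smooth vector field with $\langle n,n\rangle=-1$ and $\{l,t,n\}$ an orthonormal frame of $\mathrm{span}\{e_2,e_3,e_4\}$; the spherical curvature of $c$ is $\kappa(v)=\langle t'(v),n(v)\rangle$.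 Both are spacelike surfaces (the induced metric is Riemannian). The curve $m:u\mapsto(f(u),g(u))$ is the meridian curve, with curvature $\kappa_m=\dot f\ddot g-\dot g\ddot f$. The sign of $\dot g$ is normalized so that $\dot g=\sqrt{\dot f^2-1}$ in the elliptic case and $\dot g=\sqrt{1-\dot f^2}$ in the hyperbolic case. The surface is from the general class if $\kappa_m(u)\,\kappa(v)\neq0$ for all $u,v$. ''Determined by $\dot f=y(f)$'' means $\dot f(u)=y(f(u))$. The invariant $k$ of a spacelike surface $z=z(u,v)$ in $\mathbb{R}^4_1$: let $E=\langle z_u,z_u\rangle$, $F=\langle z_u,z_v\rangle$, $G=\langle z_v,z_v\rangle$, $W=\sqrt{EG-F^2}$. Let $\{n_1,n_2\}$ be a normal frame with $\langle n_1,n_1\rangle=1$, $\langle n_2,n_2\rangle=-1$, $\langle n_1,n_2\rangle=0$ and $\{z_u,z_v,n_1,n_2\}$ positively oriented. Put $c_{11}^i=\langle z_{uu},n_i\rangle$, $c_{12}^i=\langle z_{uv},n_i\rangle$, $c_{22}^i=\langle z_{vv},n_i\rangle$ and $$L=\frac2W(c_{11}^1c_{12}^2-c_{12}^1c_{11}^2),\quad M=\frac1W(c_{11}^1c_{22}^2-c_{22}^1c_{11}^2),\quad N=\frac2W(c_{12}^1c_{22}^2-c_{22}^1c_{12}^2).$$ Then $k=\dfrac{LN-M^2}{EG-F^2}$.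
   Formalization: As stated, ''only if'' fails when ḟ<0, since y≥0; so the equivalence with ḟ=y(f) is stated for meridians with ḟ≥0 and, with no sign condition on ḟ, with |ḟ|=y(f) in its place; I and J are open intervals. *)

(* Defs.v *)
From HB Require Import structures.
From mathcomp Require Import all_boot all_order all_algebra.
From mathcomp Require Import all_classical all_reals all_analysis.
Set Implicit Arguments.
Unset Strict Implicit.
Unset Printing Implicit Defensive.
Import Order.TTheory GRing.Theory Num.Theory.
Import numFieldNormedType.Exports.
Local Open Scope classical_set_scope.
Local Open Scope ring_scope.

(* Indices are 0-based: ebase i is the basis vector e_(i+1), so ebase 3 is the
   timelike one. *)
Definition ebase {R : realType} (i : 'I_4) : 'rV[R]_4 := delta_mx 0 i.

Definition span3 {R : realType} (i j k : 'I_4) : {vspace 'rV[R]_4} :=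
  <<[:: ebase i; ebase j; ebase k]>>%VS.

Definition mink {R : realType} (x y : 'rV[R]_4) : R :=
  \sum_(i < 4) (if i == 3 then -1 else 1) * x 0 i * y 0 i.

Definition open_interval {R : realType} (I : set R) : Prop :=
  [/\ is_interval I, open I & I !=set0].

(* On an open set I this is C^oo: derive1n is total, and the condition at each
   order k makes the derivative of order k.+1 a genuine one on I. *)
Definition smooth_on {R : realType} {V : normedModType R}
    (I : set R) (f : R -> V) : Prop :=
  forall k x, I x -> derivable (derive1n k f) x 1.

Section Surface.
Context {R : realType}.
Implicit Types z n : R -> R -> 'rV[R]_4.

Definition d_u z : R -> R -> 'rV[R]_4 :=
  fun u v => derive1 (fun s => z s v) u.
Definition d_v z : R -> R -> 'rV[R]_4 :=
  fun u v => derive1 (z u) v.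

Definition ffE z u v : R := mink (d_u z u v) (d_u z u v).
Definition ffF z u v : R := mink (d_u z u v) (d_v z u v).
Definition ffG z u v : R := mink (d_v z u v) (d_v z u v).
Definition ffW z u v : R := Num.sqrt (ffE z u v * ffG z u v - ffF z u v ^+ 2).

Definition normal_frame_at z n1 n2 u v : Prop :=
  [/\ [/\ mink (d_u z u v) (n1 u v) = 0, mink (d_v z u v) (n1 u v) = 0,
          mink (d_u z u v) (n2 u v) = 0 & mink (d_v z u v) (n2 u v) = 0],
      [/\ mink (n1 u v) (n1 u v) = 1, mink (n2 u v) (n2 u v) = -1
        & mink (n1 u v) (n2 u v) = 0]
    & 0 < \det (\matrix_(i < 4)
             nth 0 [:: d_u z u v; d_v z u v; n1 u v; n2 u v] i)].

Definition c11 z n u v : R :=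
  mink (d_u (d_u z) u v) (n u v).
Definition c12 z n u v : R :=
  mink (d_v (d_u z) u v) (n u v).
Definition c22 z n u v : R :=
  mink (d_v (d_v z) u v) (n u v).

Definition coefL z n1 n2 u v : R :=
  2 / ffW z u v
  * (c11 z n1 u v * c12 z n2 u v - c12 z n1 u v * c11 z n2 u v).
Definition coefM z n1 n2 u v : R :=
  1 / ffW z u v
  * (c11 z n1 u v * c22 z n2 u v - c22 z n1 u v * c11 z n2 u v).
Definition coefN z n1 n2 u v : R :=
  2 / ffW z u v
  * (c12 z n1 u v * c22 z n2 u v - c22 z n1 u v * c12 z n2 u v).

Definition invariant_k z n1 n2 u v : R :=
  (coefL z n1 n2 u v * coefN z n1 n2 u v - coefM z n1 n2 u v ^+ 2)
  / (ffE z u v * ffG z u v - ffF z u v ^+ 2).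

End Surface.

Section Meridian.
Context {R : realType}.
Implicit Types (I J : set R) (f g : R -> R) (l n : R -> 'rV[R]_4).

Definition elliptic_surface f g l : R -> R -> 'rV[R]_4 :=
  fun u v => f u *: l v + g u *: ebase 3.

Definition hyperbolic_surface f g l : R -> R -> 'rV[R]_4 :=
  fun u v => f u *: l v + g u *: ebase 0.

Definition meridian_curvature f g (u : R) : R :=
  derive1 f u * derive1 (derive1 g) u - derive1 g u * derive1 (derive1 f) u.

Definition spherical_curvature l n (v : R) : R :=
  mink (derive1 (derive1 l) v) (n v).

(* An orthonormal frame {x, y, w} of the three-dimensional subspace U with x, y
   spacelike; eps = 1 or -1 is the causal character of w. *)
Definition orthonormal_frame (U : {vspace 'rV[R]_4}) (eps : R)
    (x y w : 'rV[R]_4) : Prop :=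
  [/\ [/\ x \in U, y \in U & w \in U],
      [/\ mink x x = 1, mink y y = 1 & mink w w = eps]
    & [/\ mink x y = 0, mink x w = 0 & mink y w = 0]].

Record elliptic_meridian_data I J f g l n : Prop := {
  ell_I : open_interval I;
  ell_J : open_interval J;
  ell_f : smooth_on I f;
  ell_g : smooth_on I g;
  ell_l : smooth_on J l;
  ell_n : smooth_on J n;
  ell_f_gt0 : forall u, I u -> 0 < f u;
  ell_meridian : forall u, I u -> derive1 f u ^+ 2 - derive1 g u ^+ 2 = 1;
  ell_dg : forall u, I u -> derive1 g u = Num.sqrt (derive1 f u ^+ 2 - 1);
  ell_frame : forall v, J v ->
    orthonormal_frame (span3 0 1 2) 1 (l v) (derive1 l v) (n v) }.

Record hyperbolic_meridian_data I J f g l n : Prop := {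
  hyp_I : open_interval I;
  hyp_J : open_interval J;
  hyp_f : smooth_on I f;
  hyp_g : smooth_on I g;
  hyp_l : smooth_on J l;
  hyp_n : smooth_on J n;
  hyp_f_gt0 : forall u, I u -> 0 < f u;
  hyp_meridian : forall u, I u -> derive1 f u ^+ 2 + derive1 g u ^+ 2 = 1;
  hyp_dg : forall u, I u -> derive1 g u = Num.sqrt (1 - derive1 f u ^+ 2);
  hyp_frame : forall v, J v ->
    orthonormal_frame (span3 1 2 3) (-1) (l v) (derive1 l v) (n v) }.

Definition general_class I J f g l n : Prop :=
  forall u v, I u -> J v ->
    meridian_curvature f g u * spherical_curvature l n v != 0.

(* The boolean s is the choice of the sign +/-. *)
Definition y_elliptic (a b C : R) (s : bool) (t : R) : R :=
  Num.sqrt (1 + (C + (-1) ^+ s * (a * t ^+ 2 / (2 * b))) ^+ 2).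
Definition y_hyperbolic (a b C : R) (s : bool) (t : R) : R :=
  Num.sqrt (1 - (C - (-1) ^+ s * (a * t ^+ 2 / (2 * b))) ^+ 2).

Definition determined_by I f (y : R -> R) : Prop :=
  forall u, I u -> derive1 f u = y (f u).

(* Since y is a nonnegative square root, f' = y(f) can only hold where
   0 <= f'.  The constraint f'^2 -/+ g'^2 = 1 with the sign of g' fixed does not
   fix the sign of f', so without 0 <= f' the equation is f' = y(f) or
   f' = - y(f), the sign possibly depending on u. *)
Definition determined_up_to_sign I f (y : R -> R) : Prop :=
  forall u, I u -> `|derive1 f u| = y (f u).

End Meridian.

(* Main.v *)
Require Import Defs.
From HB Require Import structures.
From mathcomp Require Import all_boot all_order all_algebra ring lra.
From mathcomp Require Import all_classical all_reals all_analysis.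
Import Order.TTheory GRing.Theory Num.Theory.
Import numFieldNormedType.Exports.
Local Open Scope classical_set_scope.
Local Open Scope ring_scope.

Set Implicit Arguments.
Unset Strict Implicit.
Unset Printing Implicit Defensive.

(** The two types of meridian surface are one computation. Write the surface as
    z = f l + g w, where w is a fixed vector with <w,w> = e, orthogonal to the
    3-space of l: e = -1 and w = e_4 in the elliptic case, e = 1 and w = e_1 in
    the hyperbolic one. Then f'^2 + e g'^2 = 1 and <n,n> = -e.

    The first observation is that k = - (kappa_m kappa)^2 / f^2
    ([meridian_k]). As z_uv = f' t is tangent, the coefficients L and N vanish,
    so k = - M^2 / f^2, and f^2 M^2 is the square of the 2x2 minor of the
    coordinates of z_uu and z_vv in the normal frame. That square is minus the
    Gram determinant of their normal components, hence it does not depend on the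
    frame and can be expressed by scalar products and tangential components
    ([normal_minor_sq]); the scalar products needed come from the Frenet
    equations of the curve l ([frenet_t]) and from the equations
    f'' = - e kappa_m g', g'' = kappa_m f' of a unit speed meridian
    ([meridian_second]).

    So k = -a^2 says (kappa_m(u) kappa(v))^2 = a^2 f(u)^2. The variables separate:
    kappa^2 is constant, and by continuity on an interval so is kappa = b, and so
    is the quotient c = kappa_m / f = +- a / b. From g'' = kappa_m f' = c f f'
    one gets g' = C + c f^2 / 2 by integration, and f'^2 = 1 - e g'^2 is the
    announced equation ([meridian_ode_of_curvature_product]).

    Conversely the equation gives g'^2 = (C + c f^2 / 2)^2 wherever f' <> 0.
    Differentiating gives kappa_m^2 = c^2 f^2 wherever f' g' <> 0. The zeros of
    f' g' are isolated, because (f' g')' = kappa_m (f'^2 - e g'^2) does not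
    vanish at them, so that the identity extends to them by continuity
    ([curvature_product_of_meridian_ode]). *)

(** * Orthonormal frames of Minkowski space *)

Definition minkmx {R : realType} : 'M[R]_4 :=
  diag_mx (\row_i (if i == 3 then -1 else 1)).

Lemma mink_mx {R : realType} (x y : 'rV[R]_4) :
  mink x y = (x *m minkmx *m y^T) 0 0.
Proof.
rewrite mxE; apply: eq_bigr => i _.
by rewrite mul_mx_diag !mxE; ring.
Qed.

Lemma minkC {R : realType} (x y : 'rV[R]_4) : mink x y = mink y x.
Proof. by apply: eq_bigr => i _; ring. Qed.

Lemma minkDl {R : realType} (x y z : 'rV[R]_4) :
  mink (x + y) z = mink x z + mink y z.
Proof. by rewrite !mink_mx !mulmxDl mxE. Qed.

Lemma minkZl {R : realType} (c : R) (x y : 'rV[R]_4) :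
  mink (c *: x) y = c * mink x y.
Proof. by rewrite !mink_mx -!scalemxAl mxE. Qed.

Lemma minkDr {R : realType} (x y z : 'rV[R]_4) :
  mink z (x + y) = mink z x + mink z y.
Proof. by rewrite minkC minkDl !(minkC _ z). Qed.

Lemma minkZr {R : realType} (c : R) (x y : 'rV[R]_4) :
  mink y (c *: x) = c * mink y x.
Proof. by rewrite minkC minkZl minkC. Qed.

(** Parseval expansion. The frame is a matrix B with B eta B^T = D for the
    diagonal matrices eta and D of signs; since D^2 = 1 the matrix eta B^T D is
    a right inverse of B, hence a left inverse, and this reads B^T D B = eta. *)
Lemma mink_frame {R : realType} (eps : 'I_4 -> R) (b : 'I_4 -> 'rV[R]_4) :
  (forall i, eps i ^+ 2 = 1) ->
  (forall i j, mink (b i) (b j) = (i == j)%:R * eps i) ->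
  forall x y, mink x y = \sum_i eps i * mink x (b i) * mink y (b i).
Proof.
move=> eps2 bb x y.
pose B : 'M[R]_4 := \matrix_i b i.
pose D : 'M[R]_4 := diag_mx (\row_i eps i).
have rowB i : row i B = b i by rewrite rowK.
have gram : B *m minkmx *m B^T = D.
  apply/matrixP => i j.
  have -> : (B *m minkmx *m B^T) i j = mink (b i) (b j).
    rewrite mink_mx -!rowB -row_mul [LHS]mxE [RHS]mxE.
    by apply: eq_bigr => k _; rewrite !mxE.
  by rewrite bb !mxE; case: (i == j); rewrite ?mul1r ?mul0r.
have D2 : D *m D = 1%:M.
  apply/matrixP => i j; rewrite mul_diag_mx !mxE.
  case: (eqVneq i j) => [->|_]; last by rewrite mulr0n mulr0.
  by rewrite !mulr1n -expr2 eps2.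
have eta2 : minkmx *m minkmx = 1%:M :> 'M[R]_4.
  apply/matrixP => i j; rewrite mul_diag_mx !mxE.
  case: (eqVneq i j) => [->|_]; last by rewrite mulr0n mulr0.
  by rewrite !mulr1n; case: ifP => _; ring.
have : B *m (minkmx *m B^T *m D) = 1%:M by rewrite !mulmxA gram D2.
move=> /mulmx1C h.
have h2 : B^T *m D *m B = minkmx.
  have hA : minkmx *m (B^T *m D *m B) = 1%:M by rewrite -h !mulmxA.
  by rewrite -[LHS]mul1mx -eta2 -mulmxA hA mulmx1.
have coord (z : 'rV[R]_4) i : mink z (b i) = (z *m minkmx *m B^T) 0 i.
  rewrite mink_mx -rowB [LHS]mxE [RHS]mxE.
  by apply: eq_bigr => k _; rewrite !mxE.
transitivity ((x *m minkmx *m B^T *m D *m (y *m minkmx *m B^T)^T) 0 0).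
  rewrite !trmx_mul trmxK tr_diag_mx.
  rewrite mink_mx; congr (_ 0 0).
  transitivity (x *m (minkmx *m (B^T *m D *m B) *m minkmx) *m y^T).
    by rewrite h2 eta2 mul1mx.
  by rewrite !mulmxA.
rewrite mxE; apply: eq_bigr => i _.
by rewrite mul_mx_diag !coord mxE [X in _ * X]mxE [X in _ * X * _]mxE; ring.
Qed.

Lemma mink_frame4 {R : realType} (c d : R) (p q r s : 'rV[R]_4) :
  c ^+ 2 = 1 -> d ^+ 2 = 1 ->
  [/\ mink p p = 1, mink q q = 1, mink r r = c & mink s s = d] ->
  [/\ mink p q = 0, mink p r = 0 & mink p s = 0] ->
  [/\ mink q r = 0, mink q s = 0 & mink r s = 0] ->
  forall x y, mink x y = mink x p * mink y p + mink x q * mink y q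
    + c * mink x r * mink y r + d * mink x s * mink y s.
Proof.
move=> c2 d2 [pp qq rr ss] [pq pr ps] [qr qs rs] x y.
rewrite (@mink_frame R (fun i => [:: 1; 1; c; d]`_i)
  (fun i => [:: p; q; r; s]`_i)).
- by rewrite !big_ord_recl big_ord0 /=; ring.
- by case=> [[|[|[|[|//]]]] ?] /=; rewrite ?expr1n.
- case=> [[|[|[|[|//]]]] ?] [[|[|[|[|//]]]] ?] /=;
  rewrite ?mul1r ?mul0r //; by rewrite minkC.
Qed.

(** The function h is the scalar product of normal components, so that the right
    hand side is minus their Gram determinant. It involves only the tangent
    vectors p and q: the square of the minor is the same for all normal frames. *)
Lemma normal_minor_sq {R : realType} (p q n1 n2 : 'rV[R]_4) :
  [/\ mink p p = 1, mink q q = 1, mink n1 n1 = 1 & mink n2 n2 = -1] ->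
  [/\ mink p q = 0, mink p n1 = 0 & mink p n2 = 0] ->
  [/\ mink q n1 = 0, mink q n2 = 0 & mink n1 n2 = 0] ->
  let h x y := mink x y - mink x p * mink y p - mink x q * mink y q in
  forall x y,
    (mink x n1 * mink y n2 - mink y n1 * mink x n2) ^+ 2
    = h x y ^+ 2 - h x x * h y y.
Proof.
move=> H1 H2 H3 h x y.
have E := @mink_frame4 R 1 (-1) p q n1 n2 (expr1n _ _) (sqrr_sign _ 1) H1 H2 H3.
by rewrite /h !(E x y) (E x x) (E y y); ring.
Qed.

(** * Derivatives *)

Lemma is_derive_rowP {R : realType} (m : nat) (F : R -> 'rV[R]_m) (x : R) dF :
  is_derive x 1 F dF <->
  forall j, is_derive x 1 (fun s => F s 0 j) (dF 0 j).
Proof.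
split=> [[Fx <-] j|H].
  split; first by move/derivable_mxP: Fx.
  by rewrite derive_mx// mxE.
have Fx : derivable F x 1.
  by apply/derivable_mxP => i j; rewrite ord1; case: (H j).
split=> //; rewrite derive_mx//; apply/rowP => j; rewrite mxE.
by case: (H j).
Qed.

Lemma is_derive_mink {R : realType} (F G : R -> 'rV[R]_4) (x : R) dF dG :
  is_derive x 1 F dF -> is_derive x 1 G dG ->
  is_derive x 1 (fun s => mink (F s) (G s)) (mink dF (G x) + mink (F x) dG).
Proof.
move=> /is_derive_rowP HF /is_derive_rowP HG.
pose c (i : 'I_4) : R := if i == 3 then -1 else 1.
have -> : (fun s => mink (F s) (G s)) =
    \sum_(i < 4) (c i \*: ((fun s => F s 0 i) * (fun s => G s 0 i))).
  by apply/funext => s; rewrite fct_sumE; apply: eq_bigr => i _; rewrite /c -mulrA.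
have H i : is_derive x 1 (c i \*: ((fun s => F s 0 i) * (fun s => G s 0 i)))
    (c i *: (F x 0 i *: dG 0 i + G x 0 i *: dF 0 i)).
  by apply: is_deriveZ; apply: is_deriveM.
apply: (is_derive_eq (is_derive_sum H)).
rewrite /mink -big_split/=; apply: eq_bigr => i _; rewrite /c.
by rewrite /GRing.scale/=; ring.
Qed.

Lemma is_derive_scalev {R : realType} (f : R -> R) (w : 'rV[R]_4) (x df : R) :
  is_derive x 1 f df -> is_derive x 1 (fun s => f s *: w) (df *: w).
Proof.
move=> Hf; apply/is_derive_rowP => j.
have -> : (fun s => (f s *: w) 0 j) = w 0 j \*: f.
  by apply/funext => s; rewrite mxE mulrC.
by rewrite mxE mulrC; apply: is_deriveZ.
Qed.

Lemma derive1_is_derive {R : realType} (V : normedModType R) (f : R -> V)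
    (x : R) (df : V) :
  is_derive x 1 f df -> derive1 f x = df.
Proof. by move=> H; rewrite derive1E derive_val. Qed.

Lemma is_derive_derive1 {R : realType} (V : normedModType R) (f : R -> V)
    (x : R) :
  derivable f x 1 -> is_derive x 1 f (derive1 f x).
Proof. by move=> H; rewrite derive1E; apply/derivableP. Qed.

Lemma is_derive_continuous {R : realType} (V : normedModType R) (f : R -> V)
    (x : R) (df : V) :
  is_derive x 1 f df -> {for x, continuous f}.
Proof.
by move=> [H _]; apply/differentiable_continuous; rewrite -derivable1_diffP.
Qed.

Lemma is_derive_sqr {R : realType} (f : R -> R) (x df : R) :
  is_derive x 1 f df -> is_derive x 1 (f ^+ 2) (2 * f x * df).
Proof.
move=> Hf; apply: is_derive_eq.
by rewrite /GRing.scale/= expr1.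
Qed.

Lemma continuous_minor {R : realType} (a b c d : R -> R) (x : R) :
  {for x, continuous a} -> {for x, continuous b} ->
  {for x, continuous c} -> {for x, continuous d} ->
  {for x, continuous (fun s => a s * b s - c s * d s)}.
Proof. by move=> ca cb cc cd; apply: cvgB; apply: cvgM. Qed.

Lemma is_derive_open {R : realType} (V : normedModType R) (I : set R)
    (f g : R -> V) (x : R) (df : V) :
  open I -> I x -> (forall s, I s -> f s = g s) ->
  is_derive x 1 f df -> is_derive x 1 g df.
Proof.
move=> oI Ix fg; apply: near_eq_is_derive.
by near=> s; apply: fg; near: s; apply: open_nbhs_nbhs.
Unshelve. all: by end_near. Qed.

Lemma is_derive_open_cst {R : realType} (I : set R) (f : R -> R) (x c : R) :
  open I -> I x -> (forall s, I s -> f s = c) -> is_derive x 1 f 0.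
Proof.
move=> oI Ix fc; apply: (is_derive_open oI Ix _ (is_derive_cst (c : R^o) x 1)).
by move=> s /fc.
Qed.

Lemma zero_derive_cst {R : realType} (I : set R) (h : R -> R) :
  is_interval I -> (forall x, I x -> is_derive x 1 h 0) ->
  forall x y, I x -> I y -> h x = h y.
Proof.
move=> iI dh; suff H x y : I x -> I y -> x < y -> h x = h y.
  move=> x y Ix Iy; case: (ltgtP x y) => [|/H ->//|->//]; exact: H.
move=> Ix Iy xy.
have sI z : z \in `[x, y]%R -> I z.
  by rewrite in_itv => /iI; apply.
have [||c _] := @MVT R h (fun=> 0) x y xy.
- by move=> z /subset_itv_oo_cc zxy; apply/dh/sI.
- by apply: derivable_within_continuous => z zxy; case: (dh z (sI z zxy)).
- by rewrite mul0r => /eqP; rewrite subr_eq0 => /eqP.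
Qed.

(** A change of sign would force a zero by the intermediate value theorem. *)
Lemma sqr_cst_cst {R : realType} (I : set R) (h : R -> R) (c : R) :
  is_interval I -> c != 0 -> (forall x, I x -> {for x, continuous h}) ->
  (forall x, I x -> h x ^+ 2 = c) ->
  forall x y, I x -> I y -> h x = h y.
Proof.
move=> iI c0 ch h2; suff H x y : I x -> I y -> x < y -> h x = h y.
  move=> x y Ix Iy; case: (ltgtP x y) => [|/H ->//|->//]; exact: H.
move=> Ix Iy xy; apply/eqP/negPn/negP => hxy.
have sI z : z \in `[x, y]%R -> I z.
  by rewrite in_itv => /iI; apply.
have hyx : h y = - h x.
  have /eqP := h2 _ Ix; rewrite -(h2 _ Iy) eqf_sqr (negPf hxy)/= => /eqP ->.
  by rewrite opprK.
have [| |z /sI Iz hz] := @IVT R h x y 0 (ltW xy).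
- apply/continuous_in_subspaceT => z; rewrite inE => /= zxy.
  by apply/ch/sI.
- by rewrite hyx ge_min le_max; lra.
- by move: (h2 _ Iz) c0; rewrite hz expr0n => <-; rewrite eqxx.
Qed.

(** A zero of phi at which the derivative of phi does not vanish is isolated, so
    psi vanishes near it and by continuity at it. This extends identities
    obtained by dividing by phi. *)
Lemma eq0_at_simple_zero {R : realType} (I : set R) (phi psi : R -> R) (x d : R) :
  open I -> I x -> is_derive x 1 phi d -> {for x, continuous psi} ->
  (phi x = 0 -> d != 0) ->
  (forall s, I s -> phi s != 0 -> psi s = 0) -> psi x = 0.
Proof.
move=> oI Ix Hphi cpsi d0 H.
have [phix|phix] := eqVneq (phi x) 0; last exact: H.
(* Caratheodory's slope function q of phi at x is continuous with value d at x. *)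
have [q [qE qc qx]] := (is_derive1_caratheodory phi x d).1 Hphi.
have qn : \forall s \near x, q s != 0.
  by apply: (cvgr_neq0 _ qc); rewrite qx; exact: d0.
have P0 : \forall s \near x^', psi s = 0.
  have sx : \forall s \near x^', s != x by exact: nbhs_dnbhs_neq.
  have Is : \forall s \near x^', I s.
    by apply: cvg_within; apply: open_nbhs_nbhs.
  have qs : \forall s \near x^', q s != 0 by apply: cvg_within.
  near=> s; apply: H; first by near: s.
  have -> : phi s = q s * (s - x) by rewrite -qE phix subr0.
  by rewrite mulf_neq0 ?subr_eq0//; near: s.
have c1 : psi s @[s --> x^'] --> psi x by apply: cvg_within_filter.
have E : {near x^', cst 0 =1 psi} by near=> s; rewrite (near P0 s).
have c2 : psi s @[s --> x^'] --> (0 : R).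
  exact: (cvg_trans (near_eq_cvg E) (cvg_cst 0)).
exact: (cvg_unique _ c1 c2).
Unshelve. all: by end_near. Qed.

(** * The invariant k of a meridian surface *)

Definition meridian_surface {R : realType} (w : 'rV[R]_4) (f g : R -> R)
    (l : R -> 'rV[R]_4) : R -> R -> 'rV[R]_4 :=
  fun u v => f u *: l v + g u *: w.

(** The common form of the elliptic (e = -1) and hyperbolic (e = 1) data, with
    the frame of the 3-space completed by w to a frame of Minkowski space. *)
Record meridian_data {R : realType} (e : R) (w : 'rV[R]_4) (I J : set R)
    (f g : R -> R) (l n : R -> 'rV[R]_4) : Prop := {
  md_sign : e ^+ 2 = 1;
  md_I : open_interval I;
  md_J : open_interval J;
  md_f : smooth_on I f;
  md_g : smooth_on I g;
  md_l : smooth_on J l;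
  md_n : smooth_on J n;
  md_f_gt0 : forall u, I u -> 0 < f u;
  md_unit : forall u, I u -> derive1 f u ^+ 2 + e * derive1 g u ^+ 2 = 1;
  md_dg_ge0 : forall u, I u -> 0 <= derive1 g u;
  md_norm : forall v, J v ->
    [/\ mink (l v) (l v) = 1, mink (derive1 l v) (derive1 l v) = 1,
        mink (n v) (n v) = - e & mink w w = e];
  md_orth_l : forall v, J v ->
    [/\ mink (l v) (derive1 l v) = 0, mink (l v) (n v) = 0 & mink (l v) w = 0];
  md_orth_t : forall v, J v ->
    [/\ mink (derive1 l v) (n v) = 0, mink (derive1 l v) w = 0
      & mink (n v) w = 0] }.

(** For the quadratic form x^2 + e y^2 the acceleration (p2, q2) of a unit speed
    curve is orthogonal to its velocity (p, q), hence proportional to the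
    rotated velocity with the curvature as factor. *)
Lemma unit_speed_second {R : realType} (e p q p2 q2 : R) :
  p ^+ 2 + e * q ^+ 2 = 1 -> p * p2 + e * (q * q2) = 0 ->
  p2 = - e * (p * q2 - q * p2) * q /\ q2 = (p * q2 - q * p2) * p.
Proof.
move=> U E; split.
  transitivity (p2 * (p ^+ 2 + e * q ^+ 2) - p * (p * p2 + e * (q * q2)))
    ; last by ring.
  by rewrite U E; ring.
transitivity (q2 * (p ^+ 2 + e * q ^+ 2) - q * (p * p2 + e * (q * q2)))
    ; last by ring.
by rewrite U E; ring.
Qed.

Lemma unit_speed_simple_zero {R : realType} (e p q : R) :
  p ^+ 2 + e * q ^+ 2 = 1 -> p * q = 0 -> p ^+ 2 - e * q ^+ 2 != 0.
Proof.
move=> U /eqP; rewrite mulf_eq0 => /orP[] /eqP E; move: U; rewrite E expr0n/=.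
  by rewrite !add0r => ->; rewrite oppr_eq0 oner_eq0.
by rewrite mulr0 addr0 subr0 => ->; rewrite oner_eq0.
Qed.

Section MeridianSurface.
Context {R : realType} (e : R) (w : 'rV[R]_4) (I J : set R) (f g : R -> R)
  (l n : R -> 'rV[R]_4) (D : meridian_data e w I J f g l n).

Local Notation f' := (derive1 f).
Local Notation g' := (derive1 g).
Local Notation f'' := (derive1 f').
Local Notation g'' := (derive1 g').
Local Notation t := (derive1 l).
Local Notation t' := (derive1 t).
Local Notation z := (meridian_surface w f g l).
Local Notation km := (meridian_curvature f g).
Local Notation kappa := (spherical_curvature l n).

Let oI : open I. Proof. by case: (md_I D). Qed.
Let oJ : open J. Proof. by case: (md_J D). Qed.

Lemma is_derive_f u : I u -> is_derive u 1 f (f' u).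
Proof.
by move=> Iu; apply: is_derive_derive1;
  exact: (@md_f _ _ _ _ _ _ _ _ _ D 0%N _).
Qed.
Lemma is_derive_f' u : I u -> is_derive u 1 f' (f'' u).
Proof.
by move=> Iu; apply: is_derive_derive1;
  exact: (@md_f _ _ _ _ _ _ _ _ _ D 1%N _).
Qed.
Lemma is_derive_g u : I u -> is_derive u 1 g (g' u).
Proof.
by move=> Iu; apply: is_derive_derive1;
  exact: (@md_g _ _ _ _ _ _ _ _ _ D 0%N _).
Qed.
Lemma is_derive_g' u : I u -> is_derive u 1 g' (g'' u).
Proof.
by move=> Iu; apply: is_derive_derive1;
  exact: (@md_g _ _ _ _ _ _ _ _ _ D 1%N _).
Qed.
Lemma is_derive_l v : J v -> is_derive v 1 l (t v).
Proof.
by move=> Jv; apply: is_derive_derive1;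
  exact: (@md_l _ _ _ _ _ _ _ _ _ D 0%N _).
Qed.
Lemma is_derive_t v : J v -> is_derive v 1 t (t' v).
Proof.
by move=> Jv; apply: is_derive_derive1;
  exact: (@md_l _ _ _ _ _ _ _ _ _ D 1%N _).
Qed.

Lemma d_u_meridian u v : I u -> d_u z u v = f' u *: l v + g' u *: w.
Proof.
move=> Iu; apply: derive1_is_derive; apply: is_deriveD; apply: is_derive_scalev.
  exact: is_derive_f.
exact: is_derive_g.
Qed.

Lemma d_v_meridian u v : J v -> d_v z u v = f u *: t v.
Proof.
move=> Jv; apply: derive1_is_derive; rewrite -[X in is_derive _ _ _ X]addr0.
apply: is_deriveD; apply: is_deriveZ; exact: is_derive_l.
Qed.

Lemma d_uu_meridian u v : I u -> d_u (d_u z) u v = f'' u *: l v + g'' u *: w.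
Proof.
move=> Iu; apply: derive1_is_derive.
apply: (is_derive_open _ Iu (f := fun s => f' s *: l v + g' s *: w)) => //.
  by move=> s Is; rewrite d_u_meridian.
apply: is_deriveD; apply: is_derive_scalev.
  exact: is_derive_f'.
exact: is_derive_g'.
Qed.

Lemma d_vu_meridian u v : I u -> J v -> d_v (d_u z) u v = f' u *: t v.
Proof.
move=> Iu Jv; apply: derive1_is_derive.
have -> : d_u z u = (fun v => f' u *: l v + g' u *: w).
  by apply/funext => s; rewrite d_u_meridian.
rewrite -[X in is_derive _ _ _ X]addr0.
apply: is_deriveD; apply: is_deriveZ; exact: is_derive_l.
Qed.

Lemma d_vv_meridian u v : J v -> d_v (d_v z) u v = f u *: t' v.
Proof.
move=> Jv; apply: derive1_is_derive.
apply: (is_derive_open _ Jv (f := f u \*: t)) => //.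
  by move=> s Js; rewrite d_v_meridian.
by apply: is_deriveZ; apply: is_derive_t.
Qed.

Lemma meridian_second u : I u -> f'' u = - e * km u * g' u /\ g'' u = km u * f' u.
Proof.
move=> Iu; apply: unit_speed_second (md_unit D Iu) _.
have Hf := is_derive_sqr (is_derive_f' Iu).
have Hg := is_deriveZ e (is_derive_sqr (is_derive_g' Iu)).
have H0 : is_derive u 1 (f' ^+ 2 + e \*: g' ^+ 2) 0.
  apply: (is_derive_open_cst oI Iu (c := 1)) => s Is.
  by rewrite -(md_unit D Is).
have := @derive_val _ _ _ _ _ _ _ H0.
rewrite (@derive_val _ _ _ _ _ _ _ (is_deriveD Hf Hg)) /GRing.scale/=.
by move: (f' u) (g' u) (f'' u) (g'' u) => p q p2 q2 ?; lra.
Qed.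

Lemma mink_cst_derive (F G : R -> 'rV[R]_4) (c v : R) dF dG :
  J v -> (forall s, J s -> mink (F s) (G s) = c) ->
  is_derive v 1 F dF -> is_derive v 1 G dG ->
  mink dF (G v) + mink (F v) dG = 0.
Proof.
move=> Jv FGc HF HG; have H := is_derive_mink HF HG.
have H0 : is_derive v 1 (fun s => mink (F s) (G s)) 0.
  exact: (is_derive_open_cst oJ Jv FGc).
by rewrite -(@derive_val _ _ _ _ _ _ _ H) (@derive_val _ _ _ _ _ _ _ H0).
Qed.

(** The first three products come from differentiating the orthonormality
    relations. The last one is then the expansion of t' in the frame l, t, n, w. *)
Lemma frenet_t v : J v ->
  [/\ mink (t' v) (l v) = -1, mink (t' v) (t v) = 0, mink (t' v) w = 0
    & mink (t' v) (t' v) = 1 - e * kappa v ^+ 2].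
Proof.
move=> Jv.
have [ll tt nn ww] := md_norm D Jv.
have [lt ln lw] := md_orth_l D Jv.
have [tn tw nw] := md_orth_t D Jv.
have Hl := is_derive_l Jv; have Ht := is_derive_t Jv.
have tl : mink (t' v) (l v) = -1.
  have := mink_cst_derive Jv (fun s Js => let: And3 h _ _ := md_orth_l D Js in h)
    Hl Ht.
  by rewrite tt (minkC (l v)); move: (mink _ _) => x ?; lra.
have ttt : mink (t' v) (t v) = 0.
  have := mink_cst_derive Jv (fun s Js => let: And4 _ h _ _ := md_norm D Js in h)
    Ht Ht.
  by rewrite (minkC (t v)); move: (mink _ _) => x ?; lra.
have t'w : mink (t' v) w = 0.
  have := mink_cst_derive Jv (fun s Js => let: And3 _ h _ := md_orth_t D Js in h)
    Ht (is_derive_cst w _ _).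
  have -> : mink (t v) 0 = 0 by rewrite -(scale0r w) minkZr mul0r.
  by rewrite addr0.
split => //.
have e2 := md_sign D.
have Ne2 : (- e) ^+ 2 = 1 by rewrite sqrrN.
rewrite (mink_frame4 Ne2 e2 (md_norm D Jv) (md_orth_l D Jv) (md_orth_t D Jv)).
by rewrite tl ttt t'w /spherical_curvature; ring.
Qed.

(** The squared minor of z_uu and z_vv is f^2 (kappa_m kappa)^2. *)
Lemma meridian_k n1 n2 u v : I u -> J v -> normal_frame_at z n1 n2 u v ->
  invariant_k z n1 n2 u v = - (km u * kappa v) ^+ 2 / f u ^+ 2.
Proof.
move=> Iu Jv [[]].
rewrite d_u_meridian// d_v_meridian//.
have f0 : f u != 0 by rewrite gt_eqF// (md_f_gt0 D).
move=> zun1 zvn1 zun2 zvn2 [n11 n22 n12] _.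
have [ll tt nn ww] := md_norm D Jv.
have [lt ln lw] := md_orth_l D Jv.
have [tn tw nw] := md_orth_t D Jv.
have [t'l t't t'w t't'] := frenet_t Jv.
have [Ef'' Eg''] := meridian_second Iu.
have U := md_unit D Iu.
have e2 := md_sign D.
have tn1 : mink (t v) (n1 u v) = 0.
  by move/eqP: zvn1; rewrite minkZl mulf_eq0 (negPf f0) => /eqP.
have tn2 : mink (t v) (n2 u v) = 0.
  by move/eqP: zvn2; rewrite minkZl mulf_eq0 (negPf f0) => /eqP.
have tl := minkC (t v) (l v); rewrite lt in tl.
have wl := minkC w (l v); rewrite lw in wl.
have wt := minkC w (t v); rewrite tw in wt.
have lt' := minkC (l v) (t' v); rewrite t'l in lt'.
have wt' := minkC w (t' v); rewrite t'w in wt'.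
have lin := (@minkDl R, @minkDr R, @minkZl R, @minkZr R, ll, tt, ww, lt, lw, tw,
  tl, wl, wt,  t'l, t't, t'w, t't', lt', wt').
pose p := f' u *: l v + g' u *: w.
have pp : mink p p = 1 by rewrite /p !lin -[RHS](md_unit D Iu); ring.
have := @normal_minor_sq R p (t v) (n1 u v) (n2 u v) (And4 pp tt n11 n22).
have pt : mink p (t v) = 0 by rewrite /p !lin; ring.
move=> /(_ (And3 pt zun1 zun2) (And3 tn1 tn2 n12)).
move=> /(_ (f'' u *: l v + g'' u *: w) (f u *: t' v)).
move=> /= HA.
have c12E n' : mink (t v) (n' u v) = 0 -> c12 z n' u v = 0.
  by move=> tn'; rewrite /c12 (d_vu_meridian Iu Jv) minkZl tn' mulr0.
have c11E n' : c11 z n' u v = mink (f'' u *: l v + g'' u *: w) (n' u v).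
  by rewrite /c11 (d_uu_meridian v Iu).
have c22E n' : c22 z n' u v = mink (f u *: t' v) (n' u v).
  by rewrite /c22 (d_vv_meridian u Jv).
have {}HA : (c11 z n1 u v * c22 z n2 u v - c22 z n1 u v * c11 z n2 u v) ^+ 2
    = f u ^+ 2 * (km u * kappa v) ^+ 2.
  rewrite !c11E !c22E HA /p !lin Ef'' Eg''.
  move: U e2; move: (f u) (f' u) (g' u) (km u) (kappa v) => a b c d k U e2.
  (* Below a, b, c, d, k stand for f, f', g', kappa_m, kappa. *)
  have b2 : b ^+ 2 = 1 - e * c ^+ 2 by rewrite -U; ring.
  transitivity (a ^+ 2 * d ^+ 2 * (e ^+ 2 * c ^+ 2
    - (e ^+ 2 * c ^+ 2 + e * b ^+ 2) * (1 - e * k ^+ 2 - b ^+ 2)))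
    ; first by ring.
  rewrite b2; transitivity (a ^+ 2 * d ^+ 2 * k ^+ 2 * e ^+ 2)
    ; first by ring.
  by rewrite e2; ring.
have EG : ffE z u v * ffG z u v - ffF z u v ^+ 2 = f u ^+ 2.
  by rewrite /ffE /ffG /ffF d_u_meridian// d_v_meridian// -/p pp /p !lin; ring.
have W2 : ffW z u v ^+ 2 = f u ^+ 2.
  by rewrite /ffW EG sqr_sqrtr// sqr_ge0.
have W0 : ffW z u v != 0 by rewrite -sqrf_eq0 W2 sqrf_eq0.
rewrite /invariant_k EG; congr (_ / _).
rewrite /coefL /Defs.coefM /Defs.coefN (c12E _ tn1) (c12E _ tn2).
rewrite [in X in _ - X]exprMn HA expr_div_n expr1n W2.
move: f0 W0; move: (c11 _ _ _ _) (c11 _ _ _ _) (c22 _ _ _ _) (c22 _ _ _ _).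
move: (ffW _ _ _) (f u) (km u) (kappa v) => W F k kap x1 x2 y1 y2 f0 W0.
by field; rewrite f0 W0.
Qed.

(** * Constant k and the equation of the meridian *)

Lemma kappa_continuous v : J v -> {for v, continuous kappa}.
Proof.
move=> Jv; apply: is_derive_continuous (is_derive_mink _ _).
- by apply: is_derive_derive1; exact: (@md_l _ _ _ _ _ _ _ _ _ D 2%N _).
- by apply: is_derive_derive1; exact: (@md_n _ _ _ _ _ _ _ _ _ D 0%N _).
Qed.

Lemma km_continuous u : I u -> {for u, continuous km}.
Proof.
move=> Iu.
have cf' := is_derive_continuous (is_derive_f' Iu).
have cg' := is_derive_continuous (is_derive_g' Iu).
have cf'' : {for u, continuous f''}.
  apply: is_derive_continuous; apply: is_derive_derive1.
  exact: (@md_f _ _ _ _ _ _ _ _ _ D 2%N _).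
have cg'' : {for u, continuous g''}.
  apply: is_derive_continuous; apply: is_derive_derive1.
  exact: (@md_g _ _ _ _ _ _ _ _ _ D 2%N _).
exact: (continuous_minor cf' cg'' cg' cf'').
Qed.

(** The derivative vanishes as soon as kappa_m = c f: this is the first
    integral g' = C + c f^2 / 2. *)
Lemma is_derive_g'_sub_sqr u c : I u -> is_derive u 1 (g' - (c / 2) \*: f ^+ 2)
  ((km u - c * f u) * f' u).
Proof.
move=> Iu; have Hf := is_derive_f Iu; have Hg := is_derive_g' Iu.
have H := is_deriveB Hg (is_deriveZ (c / 2) (is_derive_sqr Hf)).
apply: (is_derive_eq H); rewrite (meridian_second Iu).2 /GRing.scale/=.
by move: (f' u) (km u) => p k; field.
Qed.

(** Separation of variables: kappa and kappa_m / f are constant, being continuous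
    of constant nonzero square, and the first integral gives the equation. *)
Lemma meridian_ode_of_curvature_product a : general_class I J f g l n -> a != 0 ->
  (forall u v, I u -> J v -> (km u * kappa v) ^+ 2 = a ^+ 2 * f u ^+ 2) ->
  exists b, [/\ b != 0, forall v, J v -> kappa v = b &
    exists C (s : bool), forall u, I u -> `|f' u| =
      Num.sqrt (1 - e * (C - e * ((-1) ^+ s * (a * f u ^+ 2 / (2 * b)))) ^+ 2)].
Proof.
move=> gc a0 H; have [iI _ [u0 Iu0]] := md_I D; have [iJ _ [v0 Jv0]] := md_J D.
have e2 := md_sign D.
have km0 u : I u -> km u != 0.
  by move=> Iu; have := gc _ _ Iu Jv0; rewrite mulf_eq0 negb_or => /andP[].
have kappa0 v : J v -> kappa v != 0.
  by move=> Jv; have := gc _ _ Iu0 Jv; rewrite mulf_eq0 negb_or => /andP[].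
have f0 u : I u -> f u != 0 by move=> Iu; rewrite gt_eqF// (md_f_gt0 D).
have kappab v : J v -> kappa v = kappa v0.
  move=> Jv; apply: (sqr_cst_cst (c := a ^+ 2 * f u0 ^+ 2 / km u0 ^+ 2) iJ) => //.
  - by rewrite !(mulf_neq0, invr_eq0, expf_neq0)// ?f0// ?km0.
  - exact: kappa_continuous.
  - move=> s Js; rewrite -(H _ _ Iu0 Js) exprMn mulrAC mulfV ?mul1r//.
    by rewrite expf_neq0// km0.
pose b := kappa v0; have b0 : b != 0 by exact: kappa0.
exists b; split => //.
pose c := km u0 / f u0.
have kmE u : I u -> km u = c * f u.
  move=> Iu; rewrite /c.
  rewrite (@sqr_cst_cst _ I (fun s => km s / f s) (a ^+ 2 / b ^+ 2) iI _ _ _ u0 u)//.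
  - by rewrite mulfVK// f0.
  - by rewrite !(mulf_neq0, invr_eq0, expf_neq0).
  - move=> s Is; apply: cvgM; first exact: km_continuous.
    by apply: cvgV; [exact: f0 | exact: (is_derive_continuous (is_derive_f Is))].
  - move=> s Is; rewrite expr_div_n.
    have := H _ _ Is Jv0; rewrite exprMn -/b => E.
    have -> : km s ^+ 2 = a ^+ 2 * f s ^+ 2 / b ^+ 2 by rewrite -E mulfK// expf_neq0.
    by field; rewrite b0 f0.
have c2 : c ^+ 2 = (e * (a / b)) ^+ 2.
  rewrite /c [RHS]exprMn e2 mul1r !expr_div_n.
  have := H _ _ Iu0 Jv0; rewrite exprMn -/b => E.
  have -> : km u0 ^+ 2 = a ^+ 2 * f u0 ^+ 2 / b ^+ 2 by rewrite -E mulfK// expf_neq0.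
  by field; rewrite b0 f0.
(* The sign s of the statement absorbs both the sign of kappa_m / f and e. *)
have [s cE] : exists s : bool, c = - (e * ((-1) ^+ s * (a / b))).
  move/eqP: c2; rewrite eqf_sqr => /orP[] /eqP ->.
    by exists true; rewrite expr1; ring.
  by exists false; rewrite expr0; ring.
exists (g' u0 - c / 2 * f u0 ^+ 2), s => u Iu.
have g'E : g' u = g' u0 - c / 2 * f u0 ^+ 2 + c / 2 * f u ^+ 2.
  have dh x : I x -> is_derive x 1 (g' - (c / 2) \*: f ^+ 2) 0.
    move=> Ix; have := is_derive_g'_sub_sqr c Ix.
    by rewrite kmE// subrr mul0r.
  have : g' u - c / 2 * f u ^+ 2 = g' u0 - c / 2 * f u0 ^+ 2.
    exact: (zero_derive_cst iI dh Iu Iu0).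
  by move=> E; rewrite -E; ring.
rewrite -sqrtr_sqr; congr Num.sqrt.
have -> : f' u ^+ 2 = 1 - e * g' u ^+ 2.
  by apply/eqP; rewrite -subr_eq opprK (md_unit D Iu).
rewrite g'E; congr (1 - e * (_ + _) ^+ 2); rewrite cE.
by move: (f u) => x; field.
Qed.

(** With c = +- a / b the claim is kappa_m^2 = c^2 f^2. It is proved first where
    f' g' <> 0, by differentiating g'^2 = P^2. The equation of the meridian is
    squared only where f' <> 0: elsewhere the expression under the square root
    may be negative. *)
Lemma curvature_product_of_meridian_ode a b C (s : bool) :
  general_class I J f g l n -> a != 0 -> b != 0 ->
  (forall v, J v -> kappa v = b) ->
  (forall u, I u -> `|f' u| =
    Num.sqrt (1 - e * (C - e * ((-1) ^+ s * (a * f u ^+ 2 / (2 * b)))) ^+ 2)) ->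
  forall u v, I u -> J v -> (km u * kappa v) ^+ 2 = a ^+ 2 * f u ^+ 2.
Proof.
move=> gc a0 b0 kappab f'E u v Iu Jv.
have e2 := md_sign D.
pose c := - (e * ((-1) ^+ s * (a / b))).
have c2 : c ^+ 2 = a ^+ 2 / b ^+ 2.
  by rewrite /c sqrrN !exprMn e2 sqrr_sign !mul1r exprVn.
pose P x := C + c / 2 * f x ^+ 2.
have {}f'E x : I x -> f' x != 0 -> g' x ^+ 2 = P x ^+ 2.
  move=> Ix f'x.
  have -> : P x = C - e * ((-1) ^+ s * (a * f x ^+ 2 / (2 * b))).
    by rewrite /P /c; field.
  move: (f'E x Ix); set Q := C - _ => E.
  have Q0 : 0 < 1 - e * Q ^+ 2 by rewrite -sqrtr_gt0 -E normr_gt0.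
  have : f' x ^+ 2 = 1 - e * Q ^+ 2.
    by rewrite -(sqr_sqrtr (ltW Q0)) -E real_normK// num_real.
  have := md_unit D Ix => U E2.
  have : e * g' x ^+ 2 = e * Q ^+ 2 by lra.
  by move/(congr1 ( *%R e)); rewrite !mulrA -expr2 e2 !mul1r.
suff H : km u ^+ 2 - c ^+ 2 * f u ^+ 2 = 0.
  rewrite kappab// exprMn (subr0_eq H) c2.
  by field.
have km0 : km u != 0.
  by have := gc _ _ Iu Jv; rewrite mulf_eq0 negb_or => /andP[].
have [f''u g''u] := meridian_second Iu.
have U := md_unit D Iu.
have dphi : is_derive u 1 (f' * g') (km u * (f' u ^+ 2 - e * g' u ^+ 2)).
  have Hf := is_derive_f' Iu; have Hg := is_derive_g' Iu.
  by apply: is_derive_eq; rewrite f''u g''u /GRing.scale/=; ring.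
(* At a zero of f' g' one of f'^2 and e g'^2 is 0 and the other is 1. *)
apply: (eq0_at_simple_zero (psi := fun x => km x ^+ 2 - c ^+ 2 * f x ^+ 2)
  oI Iu dphi).
- have cf := is_derive_continuous (is_derive_f Iu).
  have ck := km_continuous Iu.
  apply: cvgB; first exact: cvgM.
  by apply: cvgM; [exact: cvg_cst | exact: cvgM].
- by move=> E; apply: mulf_neq0 => //; exact: unit_speed_simple_zero U E.
move=> x Ix; rewrite mulf_eq0 negb_or => /andP[f'x g'x].
have Px := f'E x Ix f'x.
have dg2 : is_derive x 1 (g' ^+ 2 - (cst C + (c / 2) \*: f ^+ 2) ^+ 2)
    (2 * (g' x * (km x * f' x) - P x * (c * f x * f' x))).
  have Hg := is_derive_sqr (is_derive_g' Ix).
  have HP := is_deriveD (is_derive_cst (C : R^o) x 1)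
    (is_deriveZ (c / 2) (is_derive_sqr (is_derive_f Ix))).
  apply: (is_derive_eq (is_deriveB Hg (is_derive_sqr HP))).
  rewrite (_ : (cst C + (c / 2) \*: f ^+ 2) x = P x)//.
  rewrite (meridian_second Ix).2 /GRing.scale/=.
  by move: (P x) (f' x) (g' x) (km x) (f x) => y p q k fx; field.
have d0 : is_derive x 1 (g' ^+ 2 - (cst C + (c / 2) \*: f ^+ 2) ^+ 2) 0.
  apply: (near_eq_is_derive _ (is_derive_cst (0 : R^o) x 1)).
  have cf' := is_derive_continuous (is_derive_f' Ix).
  have f'n : \forall s \near x, f' s != 0 by exact: (cvgr_neq0 _ cf' f'x).
  have In : \forall s \near x, I s by apply: open_nbhs_nbhs.
  near=> y; have Iy : I y by near: y.
  have f'y : f' y != 0 by near: y.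
  have /eqP := f'E y Iy f'y; rewrite -subr_eq0 => /eqP.
  by move=> /esym.
have E : g' x * km x = P x * (c * f x).
  have := @derive_val _ _ _ _ _ _ _ dg2; rewrite (@derive_val _ _ _ _ _ _ _ d0).
  move/esym/eqP; rewrite mulf_eq0 pnatr_eq0/= subr_eq0 !mulrA => /eqP.
  by move/(mulIf f'x) => ->.
have P0 : P x ^+ 2 != 0 by rewrite -Px expf_neq0.
apply/eqP; rewrite subr_eq0; apply/eqP/(mulfI P0).
by rewrite -{1}Px -!exprMn E.
Unshelve. all: by end_near. Qed.

End MeridianSurface.

Section MeridianTheorem.
Context {R : realType} (e : R) (w : 'rV[R]_4) (I J : set R) (f g : R -> R)
  (l n : R -> 'rV[R]_4) (D : meridian_data e w I J f g l n).

Lemma meridian_k_cst n1 n2 a :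
  general_class I J f g l n ->
  (forall u v, I u -> J v ->
    normal_frame_at (meridian_surface w f g l) n1 n2 u v) ->
  a != 0 ->
  (forall u v, I u -> J v ->
    invariant_k (meridian_surface w f g l) n1 n2 u v = - a ^+ 2) <->
  (exists b, [/\ b != 0, forall v, J v -> spherical_curvature l n v = b &
    exists C (s : bool), forall u, I u -> `|derive1 f u| =
      Num.sqrt (1 - e * (C - e * ((-1) ^+ s * (a * f u ^+ 2 / (2 * b)))) ^+ 2)]).
Proof.
move=> gc fr a0.
have f2 u : I u -> f u ^+ 2 != 0.
  by move=> Iu; rewrite expf_neq0// gt_eqF// (md_f_gt0 D).
split=> [H|[b [b0 kb [C [s f'E]]]] u v Iu Jv].
  apply: (meridian_ode_of_curvature_product D gc a0) => u v Iu Jv.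
  have := H u v Iu Jv; rewrite (meridian_k D Iu Jv (fr u v Iu Jv)) mulNr.
  by move=> /oppr_inj <-; rewrite mulfVK// f2.
rewrite (meridian_k D Iu Jv (fr u v Iu Jv)) mulNr; congr (- _).
by rewrite (curvature_product_of_meridian_ode D gc a0 b0 kb f'E Iu Jv) mulfK// f2.
Qed.

End MeridianTheorem.

(** * The elliptic and the hyperbolic type *)

Lemma span3_coord {R : realType} (i j k m : 'I_4) (x : 'rV[R]_4) :
  m != i -> m != j -> m != k -> x \in span3 i j k -> x 0 m = 0.
Proof.
move=> mi mj mk /coord_span ->; rewrite !big_ord_recl big_ord0 /= /ebase !mxE.
by rewrite (negPf mi) (negPf mj) (negPf mk) !(andbF, mulr0, addr0).
Qed.

Lemma mink_ebase {R : realType} (x : 'rV[R]_4) m :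
  mink x (ebase m) = (if m == 3 then -1 else 1) * x 0 m.
Proof.
rewrite /mink (bigD1 m)//= big1 => [|i im].
  by rewrite addr0 !mxE !eqxx mulr1.
by rewrite !mxE (negPf im) andbF mulr0.
Qed.

(** The span of three basis vectors is orthogonal to the fourth, so the given
    frame and the basis vector [ebase m] together are an orthonormal frame. *)
Lemma meridian_data_of_frame {R : realType} (e : R) (i j k m : 'I_4)
    (I J : set R) (f g : R -> R) (l n : R -> 'rV[R]_4) :
  e = (if m == 3 then -1 else 1) -> m != i -> m != j -> m != k ->
  open_interval I -> open_interval J ->
  smooth_on I f -> smooth_on I g -> smooth_on J l -> smooth_on J n ->
  (forall u, I u -> 0 < f u) ->
  (forall u, I u -> derive1 f u ^+ 2 + e * derive1 g u ^+ 2 = 1) ->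
  (forall u, I u -> 0 <= derive1 g u) ->
  (forall v, J v ->
    orthonormal_frame (span3 i j k) (- e) (l v) (derive1 l v) (n v)) ->
  meridian_data e (ebase m) I J f g l n.
Proof.
move=> eE mi mj mk oI oJ sf sg sl sn f0 U g0 fr.
have perp x : x \in span3 i j k -> mink x (ebase m) = 0.
  by move=> xs; rewrite mink_ebase (span3_coord mi mj mk xs) mulr0.
split=> //.
- by rewrite eE; case: ifP; rewrite ?sqrrN expr1n.
- move=> v /fr[_ [ll tt nn] _]; split=> //.
  by rewrite mink_ebase mxE !eqxx mulr1.
- by move=> v /fr[[ls ts ns] _ [lt ln tn]]; split=> //; apply: perp.
- by move=> v /fr[[ls ts ns] _ [lt ln tn]]; split=> //; apply: perp.
Qed.

Lemma determined_by_abs {R : realType} (I : set R) (f y : R -> R) :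
  (forall u, I u -> 0 <= derive1 f u) ->
  determined_by I f y <-> determined_up_to_sign I f y.
Proof.
by move=> f0; split=> H u Iu; have := H u Iu; rewrite ger0_norm ?f0.
Qed.

Theorem theorem6p1 (R : realType) :
  (* (i) elliptic type *)
  (forall (I J : set R) (f g : R -> R) (l n : R -> 'rV[R]_4)
      (n1 n2 : R -> R -> 'rV[R]_4) (a : R),
    elliptic_meridian_data I J f g l n ->
    general_class I J f g l n ->
    (forall u v, I u -> J v ->
       normal_frame_at (elliptic_surface f g l) n1 n2 u v) ->
    a != 0 ->
    ((forall u, I u -> 0 <= derive1 f u) ->
      (forall u v, I u -> J v ->
         invariant_k (elliptic_surface f g l) n1 n2 u v = - a ^+ 2) <->
      (exists b : R,
         [/\ b != 0,
             forall v, J v -> spherical_curvature l n v = b,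
             exists (C : R) (s : bool),
               determined_by I f (y_elliptic a b C s)
           & forall u, I u -> derive1 g u = Num.sqrt (derive1 f u ^+ 2 - 1)]))
    /\
    ((forall u v, I u -> J v ->
        invariant_k (elliptic_surface f g l) n1 n2 u v = - a ^+ 2) <->
     (exists b : R,
        [/\ b != 0,
            forall v, J v -> spherical_curvature l n v = b,
            exists (C : R) (s : bool),
              determined_up_to_sign I f (y_elliptic a b C s)
          & forall u, I u -> derive1 g u = Num.sqrt (derive1 f u ^+ 2 - 1)])))
  /\
  (* (ii) hyperbolic type *)
  (forall (I J : set R) (f g : R -> R) (l n : R -> 'rV[R]_4)
      (n1 n2 : R -> R -> 'rV[R]_4) (a : R),
    hyperbolic_meridian_data I J f g l n ->
    general_class I J f g l n ->
    (forall u v, I u -> J v ->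
       normal_frame_at (hyperbolic_surface f g l) n1 n2 u v) ->
    a != 0 ->
    ((forall u, I u -> 0 <= derive1 f u) ->
      (forall u v, I u -> J v ->
         invariant_k (hyperbolic_surface f g l) n1 n2 u v = - a ^+ 2) <->
      (exists b : R,
         [/\ b != 0,
             forall v, J v -> spherical_curvature l n v = b,
             exists (C : R) (s : bool),
               determined_by I f (y_hyperbolic a b C s)
           & forall u, I u -> derive1 g u = Num.sqrt (1 - derive1 f u ^+ 2)]))
    /\
    ((forall u v, I u -> J v ->
        invariant_k (hyperbolic_surface f g l) n1 n2 u v = - a ^+ 2) <->
     (exists b : R,
        [/\ b != 0,
            forall v, J v -> spherical_curvature l n v = b,
            exists (C : R) (s : bool),
              determined_up_to_sign I f (y_hyperbolic a b C s)
          & forall u, I u -> derive1 g u = Num.sqrt (1 - derive1 f u ^+ 2)]))).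
Proof.
split=> I J f g l n n1 n2 a D gc fr a0.
- have D' : meridian_data (-1) (ebase 3) I J f g l n.
    case: D => oI oJ sf sg sl sn f0 U dg fm.
    apply: (meridian_data_of_frame (i := 0) (j := 1) (k := 2)) => //.
    + by move=> u Iu; rewrite mulN1r; exact: U.
    + by move=> u Iu; rewrite dg// sqrtr_ge0.
    + by move=> v Jv; rewrite opprK; exact: fm.
  have K := meridian_k_cst D' gc fr a0.
  have yE b C s t : y_elliptic a b C s t =
      Num.sqrt (1 - -1 * (C - -1 * ((-1) ^+ s * (a * t ^+ 2 / (2 * b)))) ^+ 2).
    by rewrite /y_elliptic !mulN1r !opprK.
  have {}K : (forall u v, I u -> J v ->
      invariant_k (elliptic_surface f g l) n1 n2 u v = - a ^+ 2) <->
    (exists b : R,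
       [/\ b != 0,
           forall v, J v -> spherical_curvature l n v = b,
           exists (C : R) (s : bool),
             determined_up_to_sign I f (y_elliptic a b C s)
         & forall u, I u -> derive1 g u = Num.sqrt (derive1 f u ^+ 2 - 1)]).
    split=> [/K.1|] [b [b0 kb [C [s H]]]].
      exists b; split=> //; last exact: (ell_dg D).
      by exists C, s => u Iu; rewrite yE; exact: H.
    move=> _; apply/K; exists b; split=> //.
    by exists C, s => u Iu; rewrite -yE; exact: H.
  split=> // f'0; rewrite K.
  by split=> -[b [b0 kb [C [s H]] dg]]; exists b; split=> //; exists C, s;
    apply/determined_by_abs.
- have D' : meridian_data 1 (ebase 0) I J f g l n.
    case: D => oI oJ sf sg sl sn f0 U dg fm.
    apply: (meridian_data_of_frame (i := 1) (j := 2) (k := 3)) => //.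
    + by move=> u Iu; rewrite mul1r; exact: U.
    + by move=> u Iu; rewrite dg// sqrtr_ge0.
  have K := meridian_k_cst D' gc fr a0.
  have yE b C s t : y_hyperbolic a b C s t =
      Num.sqrt (1 - 1 * (C - 1 * ((-1) ^+ s * (a * t ^+ 2 / (2 * b)))) ^+ 2).
    by rewrite /y_hyperbolic !mul1r.
  have {}K : (forall u v, I u -> J v ->
      invariant_k (hyperbolic_surface f g l) n1 n2 u v = - a ^+ 2) <->
    (exists b : R,
       [/\ b != 0,
           forall v, J v -> spherical_curvature l n v = b,
           exists (C : R) (s : bool),
             determined_up_to_sign I f (y_hyperbolic a b C s)
         & forall u, I u -> derive1 g u = Num.sqrt (1 - derive1 f u ^+ 2)]).
    split=> [/K.1|] [b [b0 kb [C [s H]]]].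
      exists b; split=> //; last exact: (hyp_dg D).
      by exists C, s => u Iu; rewrite yE; exact: H.
    move=> _; apply/K; exists b; split=> //.
    by exists C, s => u Iu; rewrite -yE; exact: H.
  split=> // f'0; rewrite K.
  by split=> -[b [b0 kb [C [s H]] dg]]; exists b; split=> //; exists C, s;
    apply/determined_by_abs.
Qed.
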